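(* If $\mathbf{C}^{\rm P}$ is symmetric, i.e. $\mathbf{C}^{\rm P}=\mathbf{C}^{\rm M}$, and at least one of the components $p(t)$, $q(t)$ of $\mathbf{r}^{\rm P}(t)$ (written in lowest terms) has a numerator of degree greater than the degree of its denominator, then $\mathbf{P}(s,t)$ covers all the real part of $\mathbf{S}$; that is, every point of $\mathbf{S}\cap\mathbb{R}^3$ is reachable by $\mathbf{P}$.
   Context: Setting: $p(t),q(t)\in\mathbb{R}(t)$ are rational functions with real coefficients, $p$ is not identically zero and $q$ is not constant. $\mathbf{r}^{\rm P}(t)=(0,p(t),q(t))$ is assumed proper, i.e. injective up to finitely many parameter values (birational onto its image curve). The profile curve $\mathbf{C}^{\rm P}$ is the complex algebraic curve in the $(y,z)$-plane $\{x=0\}\subset\mathbb{C}^3$ parametrized by $\mathbf{r}^{\rm P}$ (the Zariski closure of the image). The mirror curve $\mathbf{C}^{\rm M}$ is the curve parametrized in the same sense by $\mathbf{r}^{\rm M}(t)=(0,-p(t),q(t))$. The surface of revolution $\mathbf{S}\subset\mathbb{C}^3$ generated by rotating $\mathbf{C}^{\rm P}$ around the $z$-axis is the Zariski closure of the image of $$\mathbf{P}(s,t)=\left(\frac{2s}{1+s^2}\,p(t),\frac{1-s^2}{1+s^2}\,p(t),q(t)\right).$$ Parameters take complex values wherever the expressions are defined; a point is reachable by a parametrization if it is its value at some such complex parameter(s). Recalled fact: if $f(y,z)=A(y^2,z)+yB(y^2,z)$ is the defining polynomial of $\mathbf{C}^{\rm P}$, then $\mathbf{S}$ is the zero set of $F=A(x^2+y^2,z)$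 if $B=0$ (equivalently, if $\mathbf{C}^{\rm P}$ is symmetric), and of $F=A^2(x^2+y^2,z)-(x^2+y^2)B^2(x^2+y^2,z)$ otherwise. *)

(* Defs.v *)
From HB Require Import structures.
From mathcomp Require Import all_boot all_order all_algebra generic_quotient.
From mathcomp Require Import mathcomp_extra boolp classical_sets reals.
From mathcomp Require Import complex mpoly.

Set Implicit Arguments.
Unset Strict Implicit.
Unset Printing Implicit Defensive.

Import Order.TTheory GRing.Theory Num.Theory.

Local Open Scope ring_scope.
Local Open Scope classical_set_scope.
Local Open Scope complex_scope.

Local Notation "x %:F" := (tofrac x).

Section RationalFunctions.
Variable R : realType.
Implicit Type p : {fraction {poly R}}.

(* [repr p] is an arbitrary representative, possibly with common factors.
   Numerator and denominator in lowest terms are unique up to a common nonzero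
   constant, so degrees, values and domains do not depend on the choice. *)
Definition fnum p : {poly R} :=
  \n_(repr p) %/ gcdp \n_(repr p) \d_(repr p).

Definition fden p : {poly R} :=
  \d_(repr p) %/ gcdp \n_(repr p) \d_(repr p).

Lemma fden_neq0 p : fden p != 0.
Proof.
have d0 : \d_(repr p) != 0 by exact: denom_ratioP.
by rewrite /fden divp_eq0 negb_or d0 negb_or gcdp_eq0 negb_and d0 orbT /=
  -leqNgt leq_gcdpr.
Qed.

Lemma coprimep_fnum_fden p : coprimep (fnum p) (fden p).
Proof.
have d0 : \d_(repr p) != 0 by exact: denom_ratioP.
by apply: coprimep_div_gcd; rewrite d0 orbT.
Qed.

Lemma fracE p : p = (fnum p)%:F / (fden p)%:F.
Proof.
have d0 : \d_(repr p) != 0 by exact: denom_ratioP.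
have g0 : gcdp \n_(repr p) \d_(repr p) != 0 by rewrite gcdp_eq0 negb_and d0 orbT.
have E : p * (\d_(repr p))%:F = (\n_(repr p))%:F.
  rewrite -{1}[p]reprK; move: (repr p) d0 {g0} => x d0; unlock FracField.tofrac.
  rewrite -[LHS]FracField.pi_mul; apply/eqmodP.
  apply/eqP; rewrite /FracField.mulf /=.
  by rewrite !numden_Ratio ?mulr1 ?oner_neq0 //= mulrC.
have En := divpK (dvdp_gcdl \n_(repr p) \d_(repr p)).
have Ed := divpK (dvdp_gcdr \n_(repr p) \d_(repr p)).
have F0 : (fden p)%:F != 0 by rewrite tofrac_eq0 fden_neq0.
rewrite -/(fnum p) in En; rewrite -/(fden p) in Ed.
apply: (mulIf F0); rewrite mulfVK //.
move: (gcdp _ _) g0 En Ed E => g g0 <- <-; rewrite !tofracM mulrA.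
by apply: mulIf; rewrite tofrac_eq0.
Qed.

Definition fdom p : set R[i] :=
  [set t | (map_poly (real_complex R) (fden p)).[t] != 0].

Definition fval p (t : R[i]) : R[i] :=
  (map_poly (real_complex R) (fnum p)).[t]
  / (map_poly (real_complex R) (fden p)).[t].

End RationalFunctions.

Definition point3 (K : Type) (x y z : K) : 'rV[K]_3 :=
  \row_(i < 3) nth x [:: x; y; z] i.

Definition zariski_closure (K : fieldType) (n : nat) (X : set 'rV[K]_n) :
    set 'rV[K]_n :=
  [set v : 'rV[K]_n | forall f : {mpoly K[n]},
     (forall u, X u -> f.@[u ord0] = 0) -> f.@[v ord0] = 0].

Section SurfaceOfRevolution.
Variable R : realType.
Implicit Types p q : {fraction {poly R}}.

Definition profile_param p q (t : R[i]) : 'rV[R[i]]_3 :=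
  point3 0 (fval p t) (fval q t).

Definition mirror_param p q (t : R[i]) : 'rV[R[i]]_3 :=
  point3 0 (- fval p t) (fval q t).

Definition revolution_param p q (s t : R[i]) : 'rV[R[i]]_3 :=
  point3 (2 * s / (1 + s ^+ 2) * fval p t)
         ((1 - s ^+ 2) / (1 + s ^+ 2) * fval p t)
         (fval q t).

Definition profile_curve p q : set 'rV[R[i]]_3 :=
  zariski_closure [set profile_param p q t | t in fdom p `&` fdom q].

Definition mirror_curve p q : set 'rV[R[i]]_3 :=
  zariski_closure [set mirror_param p q t | t in fdom p `&` fdom q].

Definition revolution_image p q : set 'rV[R[i]]_3 :=
  [set v : 'rV[R[i]]_3 | exists s t, [/\ 1 + s ^+ 2 != 0, fdom p t, fdom q t
                         & v = revolution_param p q s t]].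

Definition revolution_surface p q : set 'rV[R[i]]_3 :=
  zariski_closure (revolution_image p q).

Definition proper_profile p q : Prop :=
  exists E : seq R[i],
    {in [pred t | t \notin E] &, forall t1 t2,
       (fdom p `&` fdom q) t1 -> (fdom p `&` fdom q) t2 ->
       profile_param p q t1 = profile_param p q t2 -> t1 = t2}.

Definition real_points : set 'rV[R[i]]_3 :=
  [set map_mx (real_complex R) w | w in [set: 'rV[R]_3]].

End SurfaceOfRevolution.

Arguments real_points : clear implicits.

(* Main.v *)
Require Import Defs.
From HB Require Import structures.
From mathcomp Require Import all_boot all_order all_algebra generic_quotient.
From mathcomp Require Import mathcomp_extra boolp classical_sets reals.
From mathcomp Require Import complex mpoly.
From mathcomp Require Import ring.

Set Implicit Arguments.
Unset Strict Implicit.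
Unset Printing Implicit Defensive.

Import Order.TTheory GRing.Theory Num.Theory.

Local Open Scope ring_scope.
Local Open Scope classical_set_scope.

(** Everything happens on a meridian.  Let [v = (x, y, z)] be a real point of the
surface and [r] a complex number with [r ^+ 2 = x ^+ 2 + y ^+ 2].

The point [(0, r, z)] lies on the profile curve ([meridian_of_surface_point]).
On the plane of the profile a polynomial [f] has the form [A + r * B], where
[A] and [B] are polynomials in [r ^+ 2] and [z], hence in
[x ^+ 2 + y ^+ 2] and [z] ([meridian_even_odd]).  If [f] vanishes on the
profile curve, symmetry makes it vanish at both [(0, r, z)] and [(0, - r, z)]
for every point of the curve, so that [A] and [r ^+ 2 * B] vanish there.  Both
are rotation invariant, so they vanish on the whole surface, in particular
at [v].

The degree hypothesis makes the parametrization of the profile curve reach every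
point of the curve ([profile_curve_covered]): as the parameter goes to infinity
the curve leaves the affine plane, so the closure adds no affine point to the
image.  In algebraic terms, if [p = a / b] with [deg a > deg b] and [q = c / d],
then the parameter is integral over the polynomials in [p], and lying over
provides a parameter above each point of the closure; the roles of [p] and [q]
can be exchanged.  Here lying over is made explicit by
a norm ([parametrization_covers]): with [M] a companion matrix of [a - Y b], the
determinant of [c(M) - Z d(M)] is a polynomial in [Y] and [Z] which vanishes at
a point exactly when [a - Y b] and [c - Z d] have a common root there.

Finally, the rational parametrization of the circle of radius [r] misses only
the point [(0, - r)] ([circle_param_onto]).  As both [r] and [- r] are allowed, a
point with [x ^+ 2 + y ^+ 2 != 0] is missed for at most one choice of the sign.
When [x ^+ 2 + y ^+ 2 = 0], reality of the point forces [x = y = 0], and any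
parameter of the circle will do. *)

(** * Common roots as vanishing of a determinant *)

Lemma det_horner_mx_root (F : fieldType) (n : nat) (M : 'M[F]_n.+1)
    (g : {poly F}) (t : F) :
  root (char_poly M) t -> root g t -> \det (horner_mx M g) = 0.
Proof.
rewrite -eigenvalue_root_char => /eigenvalueP[v vM v0] /factor_theorem[h ->].
rewrite rmorphM /= rmorphB /= horner_mx_X horner_mx_C det_mulmx.
suff -> : \det (M - t%:M) = 0 by rewrite mulr0.
apply/eqP/det0P; exists v => //.
by rewrite mulmxBr vM mul_mx_scalar subrr.
Qed.

(** A Bezout relation evaluated at [M] exhibits an inverse of [g(M)], because the
characteristic polynomial vanishes at [M]. *)
Lemma det_horner_mx_coprimep (F : fieldType) (n : nat) (M : 'M[F]_n.+1)
    (g : {poly F}) :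
  coprimep (char_poly M) g -> \det (horner_mx M g) != 0.
Proof.
move=> /Bezout_eq1_coprimepP[[u v] /= /(congr1 (horner_mx M))].
rewrite rmorphD !rmorphM /= Cayley_Hamilton mulr0 add0r rmorph1.
move=> /(congr1 determinant); rewrite det_mulmx det1 => E.
by apply/eqP=> g0; move/eqP: E; rewrite g0 mulr0 eq_sym oner_eq0.
Qed.

(** The companion matrix, with a dimension that is visibly positive, so that
square matrices of this size form a ring in which to evaluate polynomials. *)
Lemma exists_char_poly (A : comNzRingType) (n : nat) (p : {poly A}) :
  p \is monic -> size p = n.+2 -> exists M : 'M[A]_n.+1, char_poly M = p.
Proof.
move=> /companionmxK + sz; move: (companionmx p); rewrite sz /= => M MP.
by exists M.
Qed.

(** * A parametrization with a pole at infinity covers its closure *)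

Section Pencil.
Variables (K : fieldType) (n : nat).

(** The equation [a(T) / b(T) = 'X_i] for the parameter [T] of a point whose
[i]-th coordinate is [a / b], with the denominator cleared. *)
Definition pencil (i : 'I_n) (a b : {poly K}) : {poly {mpoly K[n]}} :=
  map_poly (mpolyC n (R:=K)) a - 'X_i *: map_poly (mpolyC n (R:=K)) b.

Lemma map_pencil (u : 'I_n -> K) i a b :
  map_poly (meval u) (pencil i a b) = a - u i *: b.
Proof.
have E p : map_poly (meval u) (map_poly (mpolyC n (R:=K)) p) = p.
  by apply/polyP=> k; rewrite !coef_map_id0 ?meval0 ?mpolyC0 // mevalC.
apply/polyP=> k; rewrite coef_map /= !coefD !coefN !coefZ mevalB mevalM mevalXU.
by rewrite -!coef_map /= !E.
Qed.

Lemma size_pencil i (a b : {poly K}) :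
  (size b < size a)%N -> size (pencil i a b) = size a.
Proof.
have sz g : size (map_poly (mpolyC n (R:=K)) g) = size g.
  rewrite size_map_inj_poly ?mpolyC0 // => x y /eqP.
  by rewrite mpolyC_eq => /eqP.
move=> ba; rewrite size_polyDl ?sz //.
by rewrite size_polyN (leq_ltn_trans (size_scale_leq _ _)) ?sz.
Qed.

Lemma monic_pencil i (a b : {poly K}) :
  (size b < size a)%N -> a \is monic -> pencil i a b \is monic.
Proof.
move=> ba /monicP am; apply/monicP; rewrite /lead_coef size_pencil //.
rewrite coefD coefN coefZ !coef_map_id0 ?mpolyC0 // -/(lead_coef a) am.
rewrite (nth_default _ (_ : size b <= _)%N) ?mpolyC0 ?mulr0 ?subr0 //.
by rewrite -ltnS (ltn_predK ba).
Qed.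

End Pencil.

(** The polynomial that separates a point off the image is the determinant of
[c - 'X_j d] evaluated at a matrix whose characteristic polynomial is
[a - 'X_i b], normalized to be monic.  Such a matrix exists over the polynomials
because the leading coefficient does not involve ['X_i] when
[deg b < deg a]: no root escapes to infinity as the point varies. *)
Lemma parametrization_covers (K : closedFieldType) (n : nat) (i j : 'I_n)
    (a b c d : {poly K}) (w : 'I_n -> K) :
  b != 0 -> (size b < size a)%N ->
  (forall f : {mpoly K[n]},
     (forall u t, a.[t] = u i * b.[t] -> c.[t] = u j * d.[t] -> f.@[u] = 0) ->
     f.@[w] = 0) ->
  exists t, a.[t] = w i * b.[t] /\ c.[t] = w j * d.[t].
Proof.
move=> b0 ba closure_w.
have [m sza] : exists m, size a = m.+2.
  move: ba; rewrite -size_poly_gt0 in b0.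
  by case: (size a) (size b) b0 => [|[|m]] [|k] //; exists m.
have l0 : (lead_coef a)^-1 != 0.
  by rewrite invr_eq0 lead_coef_eq0 -size_poly_gt0 sza.
set l := _^-1 in l0.
have sz : (size (l *: b) < size (l *: a))%N by rewrite !size_scale.
have am : l *: a \is monic.
  by apply/monicP; rewrite lead_coefZ mulVf // -invr_eq0.
have [|M MP] := exists_char_poly (n := m) (monic_pencil i sz am).
  by rewrite size_pencil // size_scale.
(* Over each point [u], the eigenvalues of [M] are the solutions of the [i]-th
   equation. *)
have charM u : char_poly (map_mx (meval u) M) = l *: (a - u i *: b).
  by rewrite -map_char_poly MP map_pencil scalerBr !scalerA mulrC.
pose f := \det (horner_mx M (pencil j c d)).
have fE u : f.@[u] = \det (horner_mx (map_mx (meval u) M) (c - u j *: d)).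
  by rewrite -map_pencil -map_horner_mx det_map_mx.
have: f.@[w] = 0.
  apply: closure_w => u t au cu; rewrite fE.
  apply: (@det_horner_mx_root _ _ _ _ t); rewrite /root ?charM !hornerE ?au ?cu.
    by rewrite subrr mulr0.
  by rewrite subrr.
rewrite fE => f0.
have: ~~ coprimep (a - w i *: b) (c - w j *: d).
  apply: contra_eqN f0 => cop; apply: det_horner_mx_coprimep.
  by rewrite charM coprimepZl.
rewrite coprimep_def => /closed_rootP[t]; rewrite root_gcd => /andP[].
rewrite /root !hornerE !subr_eq0 => /eqP ta /eqP tc.
by exists t.
Qed.

(** * From the surface to the profile curve *)

(** Splitting [f] on the plane [x = 0] into even and odd parts in [r], and
replacing [r ^+ 2] by [x ^+ 2 + y ^+ 2].  The polynomials having such a splitting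
form a subring containing the variables. *)
Lemma meridian_even_odd (K : comNzRingType) (f : {mpoly K[3]}) :
  exists A B : {mpoly K[3]}, forall x y z r : K, x ^+ 2 + y ^+ 2 = r ^+ 2 ->
    f.@[point3 0 r z ord0] =
    A.@[point3 x y z ord0] + r * B.@[point3 x y z ord0].
Proof.
pose splits (g : {mpoly K[3]}) := exists A B : {mpoly K[3]},
  forall x y z r : K, x ^+ 2 + y ^+ 2 = r ^+ 2 ->
    g.@[point3 0 r z ord0] =
    A.@[point3 x y z ord0] + r * B.@[point3 x y z ord0].
have splitsC c : splits c%:MP.
  by exists c%:MP, 0 => x y z r _; rewrite meval0 !mevalC mulr0 addr0.
have splitsM g h : splits g -> splits h -> splits (g * h).
  move=> [A [B gE]] [A' [B' hE]].
  exists (A * A' + ('X_ord0 ^+ 2 + 'X_(inord 1) ^+ 2) * (B * B')).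
  exists (A * B' + A' * B) => x y z r xyr.
  rewrite mevalM (gE _ _ _ _ xyr) (hE _ _ _ _ xyr).
  rewrite !(mevalD, mevalM, rmorphXn, mevalXU) !mxE inordK //= xyr; ring.
have splitsX i : splits 'X_i.
  case: i => [[|[|[|//]]] lti].
  - by exists 0, 0 => x y z r _; rewrite mevalXU !meval0 mulr0 addr0 mxE.
  - by exists 0, 1 => x y z r _; rewrite mevalXU meval0 meval1 mulr1 add0r mxE.
  - exists 'X_(Ordinal lti), 0 => x y z r _.
    by rewrite meval0 !mevalXU mulr0 addr0 !mxE.
elim/mpolyind: f => [|c m f _ _ [A [B fE]]];
  first by have := splitsC 0; rewrite mpolyC0.
have [A' [B' mE]] : splits (c *: 'X_[m]).
  rewrite -mul_mpolyC mpolyXE_id; apply: (splitsM) => //.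
  elim/big_ind: _ => [|g h|i _]; [|exact: splitsM|].
    by have := splitsC 1; rewrite mpolyC1.
  elim: (m i) => [|k IH]; first by have := splitsC 1; rewrite mpolyC1 expr0.
  by rewrite exprS; apply: splitsM.
exists (A' + A), (B' + B) => x y z r xyr.
by rewrite !mevalD (mE _ _ _ _ xyr) (fE _ _ _ _ xyr); ring.
Qed.

Lemma zariski_closure_subset (K : fieldType) (n : nat) (X : set 'rV[K]_n) :
  X `<=` zariski_closure X.
Proof. by move=> u Xu f; exact. Qed.

Lemma circle_param_norm (K : fieldType) (s : K) : 1 + s ^+ 2 != 0 ->
  (2 * s / (1 + s ^+ 2)) ^+ 2 + ((1 - s ^+ 2) / (1 + s ^+ 2)) ^+ 2 = 1.
Proof. by move=> s0; field. Qed.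

(** Adding and subtracting the equations [A + r B = 0] and [A - r B = 0], which hold
on the profile and on its mirror image, isolates the rotation-invariant
polynomials [A] and [(x ^+ 2 + y ^+ 2) B].  The factor makes the odd part [r B] a
polynomial in the ambient coordinates and costs nothing at the end, as [r B = 0]
follows from [r ^+ 2 B = 0]. *)
Lemma meridian_of_surface_point (R : realType) (p q : {fraction {poly R}})
    (x y z r : complex R) :
  profile_curve p q = mirror_curve p q ->
  revolution_surface p q (point3 x y z) -> x ^+ 2 + y ^+ 2 = r ^+ 2 ->
  profile_curve p q (point3 0 r z).
Proof.
move=> sym Sv xyr f f0.
have fN t : fdom p t -> fdom q t -> f.@[mirror_param p q t ord0] = 0.
  move=> pt qt; have : mirror_curve p q (mirror_param p q t).
    by apply: zariski_closure_subset; exists t.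
  by rewrite -sym; apply.
have [A [B fE]] := meridian_even_odd f.
have AB0 u : revolution_image p q u ->
    A.@[u ord0] = 0 /\ (u ord0 ord0 ^+ 2 + u ord0 (inord 1) ^+ 2) * B.@[u ord0] = 0.
  move=> [s [t [s0 pt qt ->]]].
  set a := 2 * s / (1 + s ^+ 2) * fval p t.
  set b := (1 - s ^+ 2) / (1 + s ^+ 2) * fval p t.
  have ab : a ^+ 2 + b ^+ 2 = fval p t ^+ 2.
    by rewrite [a ^+ 2]exprMn [b ^+ 2]exprMn -mulrDl circle_param_norm // mul1r.
  have abN : a ^+ 2 + b ^+ 2 = (- fval p t) ^+ 2 by rewrite sqrrN.
  (* Both signs of the radius give the same rotation-invariant values. *)
  have := f0 (profile_param p q t); rewrite (fE _ _ _ _ ab) => /(_ _)/wrap[].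
    by exists t.
  have := fN t pt qt; rewrite (fE _ _ _ _ abN) -/(revolution_param p q s t).
  move: (A.@[_]) (B.@[_]) => A' B' /= eN eP.
  have two0 : 2 != 0 :> complex R by rewrite pnatr_eq0.
  rewrite !mxE inordK //= ab; split; apply: (mulfI two0); rewrite mulr0.
    by rewrite -[RHS](addr0 0) -{1}eN -eP; ring.
  transitivity (fval p t * (A' + fval p t * B' - (A' + - fval p t * B'))).
    by ring.
  by rewrite eN eP subrr mulr0.
have Av : A.@[point3 x y z ord0] = 0 by apply: Sv => u /AB0[].
have : (('X_ord0 ^+ 2 + 'X_(inord 1) ^+ 2) * B).@[point3 x y z ord0] = 0.
  by apply: Sv => u /AB0[_ <-]; rewrite !(mevalD, mevalM, rmorphXn, mevalXU).
rewrite !(mevalD, mevalM, rmorphXn, mevalXU) !mxE inordK //= xyr => /eqP.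
rewrite (fE _ _ _ _ xyr) Av add0r mulf_eq0 expf_eq0 /=.
by case/orP=> /eqP->; rewrite ?mul0r ?mulr0.
Qed.

(** * Every point of the profile curve has a parameter *)

(** With denominators cleared, a pole of [p] is never a solution: the numerator
would vanish there too, against coprimality. *)
Lemma fval_eq (R : realType) (p : {fraction {poly R}}) (t y : complex R) :
  (map_poly (real_complex R) (fnum p)).[t] =
    y * (map_poly (real_complex R) (fden p)).[t] ->
  fdom p t /\ fval p t = y.
Proof.
move=> E; have d0 : (map_poly (real_complex R) (fden p)).[t] != 0.
  apply/eqP=> d0; have := coprimep_fnum_fden p.
  rewrite -(coprimep_map (real_complex R)) => /coprimep_root/(_ (_ : root _ t)).
  by rewrite /root E d0 mulr0 => /(_ (eqxx _)); rewrite eqxx.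
by split=> //; rewrite /fval E mulfK.
Qed.

Lemma profile_curve_covered (R : realType) (p q : {fraction {poly R}})
    (y z : complex R) :
  (size (fden p) < size (fnum p))%N \/ (size (fden q) < size (fnum q))%N ->
  profile_curve p q (point3 0 y z) ->
  exists t, [/\ fdom p t, fdom q t, fval p t = y & fval q t = z].
Proof.
pose C g := map_poly (real_complex R) g.
have den0 g : C (fden g) != 0 by rewrite map_poly_eq0 fden_neq0.
have lt g : (size (fden g) < size (fnum g))%N ->
    (size (C (fden g)) < size (C (fnum g)))%N by rewrite !size_map_poly.
move=> deg Cyz.
suff [t [/fval_eq[pt py] /fval_eq[qt qz]]] : exists t,
    (C (fnum p)).[t] = y * (C (fden p)).[t] /\
    (C (fnum q)).[t] = z * (C (fden q)).[t] by exists t.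
have closure_w (f : {mpoly (complex R)[3]}) :
    (forall u t, (C (fnum p)).[t] = u (inord 1) * (C (fden p)).[t] ->
       (C (fnum q)).[t] = u (inord 2) * (C (fden q)).[t] -> f.@[u] = 0) ->
    f.@[point3 0 y z ord0] = 0.
  move=> f0; apply: Cyz => u [t [pt qt] <-]; apply: (f0 _ t);
    by rewrite !mxE inordK //= divfK.
have yE : y = point3 0 y z ord0 (inord 1) by rewrite mxE inordK.
have zE : z = point3 0 y z ord0 (inord 2) by rewrite mxE inordK.
case: deg => deg.
  by have := parametrization_covers (den0 p) (lt p deg) closure_w; rewrite -yE -zE.
have closure_w' (f : {mpoly (complex R)[3]}) :
    (forall u t, (C (fnum q)).[t] = u (inord 2) * (C (fden q)).[t] ->
       (C (fnum p)).[t] = u (inord 1) * (C (fden p)).[t] -> f.@[u] = 0) ->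
    f.@[point3 0 y z ord0] = 0.
  by move=> f0; apply: closure_w => u t ? ?; apply: (f0 _ t).
have := parametrization_covers (den0 q) (lt q deg) closure_w'.
by rewrite -yE -zE => -[t [? ?]]; exists t.
Qed.

(** * Covering the real part of the surface *)

(** The parameter is the stereographic projection from the missing point
[(0, - r)]. *)
Lemma circle_param_onto (K : fieldType) (x y r : K) : 2 != 0 :> K ->
  x ^+ 2 + y ^+ 2 = r ^+ 2 -> r != 0 -> r + y != 0 ->
  exists s, [/\ 1 + s ^+ 2 != 0, 2 * s / (1 + s ^+ 2) * r = x
              & (1 - s ^+ 2) / (1 + s ^+ 2) * r = y].
Proof.
move=> two0 xyr r0 ry0; exists (x / (r + y)).
have x2 : x ^+ 2 = r ^+ 2 - y ^+ 2 by rewrite -xyr addrK.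
have E : 1 + (x / (r + y)) ^+ 2 = 2 * r / (r + y).
  by rewrite expr_div_n x2; field.
rewrite E; split.
- by rewrite !mulf_neq0 ?invr_eq0.
- by field; rewrite two0 r0 ry0.
- by rewrite expr_div_n x2; field; rewrite two0 r0 ry0.
Qed.

Theorem corollary2p2 (R : realType) (p q : {fraction {poly R}})
  (p_neq0 : p != 0)
  (q_nonconst : forall c : R, q <> tofrac c%:P)
  (r_proper : proper_profile p q)
  (symmetric : profile_curve p q = mirror_curve p q)
  (deg_gt : (size (fden p) < size (fnum p))%N \/
            (size (fden q) < size (fnum q))%N) :
  revolution_surface p q `&` real_points R `<=` revolution_image p q.
Proof.
move=> v [Sv [w _ wv]].
have [x [y [z vE]]] : exists x y z : R, v =
    point3 (real_complex R x) (real_complex R y) (real_complex R z).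
  exists (w ord0 ord0), (w ord0 (inord 1)), (w ord0 (inord 2)); rewrite -wv.
  apply/rowP=> i; rewrite !mxE.
  by case: i => [[|[|[|//]]] lti] /=; do 2![congr (_ _)]; apply: val_inj; rewrite /= ?inordK.
rewrite {}vE in Sv *.
set X := real_complex R x in Sv *; set Y := real_complex R y in Sv *.
set Z := real_complex R z in Sv *.
have two0 : 2 != 0 :> complex R by rewrite pnatr_eq0.
have lift r : X ^+ 2 + Y ^+ 2 = r ^+ 2 ->
    exists t, [/\ fdom p t, fdom q t, fval p t = r & fval q t = Z].
  move=> xyr; apply: profile_curve_covered => //.
  exact: meridian_of_surface_point xyr.
have [/eqP xy0|xy0] := boolP (X ^+ 2 + Y ^+ 2 == 0).
  have : x ^+ 2 + y ^+ 2 == 0.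
    by rewrite -(fmorph_eq0 (real_complex R)) rmorphD !rmorphXn /= xy0.
  rewrite paddr_eq0 ?sqr_ge0 // !sqrf_eq0 => /andP[/eqP x0 /eqP y0].
  have [|t [pt qt p0 qz]] := lift 0; first by rewrite xy0 expr0n.
  exists 0, t; split=> //; first by rewrite expr0n addr0 oner_eq0.
  by rewrite /revolution_param p0 qz !mulr0 /X /Y x0 y0 rmorph0.
suff [r [xyr r0 rY]] : exists r, [/\ X ^+ 2 + Y ^+ 2 = r ^+ 2, r != 0 & r + Y != 0].
  have [t [pt qt pr qz]] := lift r xyr.
  have [s [s0 sx sy]] := circle_param_onto two0 xyr r0 rY.
  by exists s, t; split=> //; rewrite /revolution_param pr qz sx sy.
pose r := sqrtC (X ^+ 2 + Y ^+ 2).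
have xyr : X ^+ 2 + Y ^+ 2 = r ^+ 2 by rewrite sqrtCK.
have r0 : r != 0 by rewrite sqrtC_eq0.
(* The point is the one missed with radius [r]; it is reached with [- r]. *)
have [rY|] := boolP (r + Y == 0); last by exists r.
exists (- r); rewrite sqrrN oppr_eq0; split=> //.
have -> : - r + Y = (r + Y) - 2 * r by ring.
by rewrite (eqP rY) sub0r oppr_eq0 mulf_neq0.
Qed.
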